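(* Let $q$ be a prime power. If $H\leq \mathrm{GL}_2(\mathbb{F}_q)$ is transitive on $\Omega_q$, then $H$ has the EKR property (in its action on $\Omega_q$). Moreover, any intersecting set of $H$ is contained in a coset of the stabilizer in $H$ of an element of $\Omega_q$, or in a coset of the (setwise) stabilizer in $H$ of a line of $\mathcal{O}_2$.
   Context: $\mathrm{GL}_2(\mathbb{F}_q)$ acts by left multiplication on $\Omega_q := \mathbb{F}_q^2\setminus\{0\}$. For a subgroup $H\leq\mathrm{GL}_2(\mathbb{F}_q)$, a subset $\mathcal{F}\subset H$ is intersecting if for all $A,B\in\mathcal{F}$ there exists $u\in\Omega_q$ with $Au=Bu$. A subgroup $H$ transitive on $\Omega_q$ has the EKR property if every intersecting set $\mathcal{F}\subset H$ has size at most the order of the stabilizer in $H$ of a point of $\Omega_q$. $\mathcal{O}_2$ is the set of lines of the affine plane $\mathrm{AG}(2,q)$ not containing the zero vector, i.e. the sets $v+\langle u\rangle=\{v+tu \mid t\in\mathbb{F}_q\}$ with $u,v\in\mathbb{F}_q^2$ linearly independent; matrices act on it by $A(v+\langle u\rangle)=Av+\langle Au\rangle$. A coset of a subgroup $S\leq H$ is a set of the form $AS$ with $A\in H$. *)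

(* Defs.v *)
From HB Require Import structures.
From mathcomp Require Import all_boot all_order all_algebra all_fingroup.

Set Implicit Arguments.
Unset Strict Implicit.
Unset Printing Implicit Defensive.

Import GRing.Theory.
Local Open Scope ring_scope.

(* Left multiplication on column vectors is a left action, whereas the actions
   of mathcomp's action.v are right actions; hence transitivity and stabilizers
   are spelled out here instead of being taken from that file. *)

Definition glact (F : finFieldType) (A : {'GL_2[F]}) (u : 'cV[F]_2) : 'cV[F]_2 :=
  GLval A *m u.

Definition Omega (F : finFieldType) : {set 'cV[F]_2} := [set u | u != 0].

Definition transitive_on_Omega (F : finFieldType) (H : {group {'GL_2[F]}}) : Prop :=
  forall u v, u \in Omega F -> v \in Omega F -> exists2 A, A \in H & glact A u = v.

Definition intersecting (F : finFieldType) (S : {set {'GL_2[F]}}) : Prop :=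
  forall A B, A \in S -> B \in S -> exists2 u, u \in Omega F & glact A u = glact B u.

Definition point_stab (F : finFieldType) (H : {group {'GL_2[F]}}) (u : 'cV[F]_2) :
    {set {'GL_2[F]}} :=
  [set A in H | glact A u == u].

Definition EKR_property (F : finFieldType) (H : {group {'GL_2[F]}}) : Prop :=
  forall S : {set {'GL_2[F]}}, S \subset H -> intersecting S ->
  forall u, u \in Omega F -> (#|S| <= #|point_stab H u|)%N.

Definition line (F : finFieldType) (v u : 'cV[F]_2) : {set 'cV[F]_2} :=
  [set v + t *: u | t : F].

Definition O2 (F : finFieldType) : {set {set 'cV[F]_2}} :=
  [set L | [exists v : 'cV[F]_2, exists u : 'cV[F]_2,
              free [:: u; v] && (L == line v u)]].

(* The image of line v u under glact A is line (glact A v) (glact A u). *)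
Definition line_stab (F : finFieldType) (H : {group {'GL_2[F]}})
    (L : {set 'cV[F]_2}) : {set {'GL_2[F]}} :=
  [set A in H | glact A @: L == L].

Definition in_coset_of (F : finFieldType) (H : {group {'GL_2[F]}})
    (K S : {set {'GL_2[F]}}) : Prop :=
  exists2 A, A \in H & S \subset (A *: K)%g.

(* Main.v *)
Require Import Defs.
From mathcomp Require Import all_boot all_order all_algebra all_fingroup.
From mathcomp Require Import mxabelem.

(** Translating by a member [A0] of an intersecting set [S], the matrices
    [A - A0] form a family containing [0] whose pairwise differences are all
    singular.  In dimension 2 such a family has a common nonzero vector in its
    right kernels or a common nonzero covector in its left kernels.  In the first
    case [S] lies in a coset of a point stabilizer; in the second case it lies in
    a coset of the stabilizer of a covector [g], hence of the line [g x = 1].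

    For the bound on [#|S|], [A - 1] and its transpose have the same nullity, so
    every [A] fixes as many covectors as vectors; double counting shows that
    covector stabilizers have on average the size of point stabilizers, while no
    covector stabilizer can be smaller than that since [H] is transitive on
    nonzero vectors. *)

Set Implicit Arguments.
Unset Strict Implicit.
Unset Printing Implicit Defensive.

Import GroupScope GRing.Theory.
Local Open Scope ring_scope.

(** * Families of singular matrices of order 2 with singular differences *)

Lemma ker_col2_parallel (F : fieldType) m (M : 'M[F]_(m, 2)) (w y : 'cV[F]_2) :
  M != 0 -> w != 0 -> M *m w = 0 -> M *m y = 0 -> exists c, y = c *: w.
Proof.
move=> M0 w0 Mw My.
(* A nonzero matrix with two columns has rank at least 1, so its kernel is at most a line. *)
have rk_le1 : (\rank (kermx M^T) <= 1)%N.
  by rewrite mxrank_ker mxrank_tr leq_subLR addn1 ltnS lt0n mxrank_eq0.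
have sub_ker (z : 'cV_2) : M *m z = 0 -> (z^T <= kermx M^T)%MS.
  by move=> Mz; apply/sub_kermxP; rewrite -trmx_mul Mz trmx0.
have : (kermx M^T <= w^T)%MS.
  rewrite -(geq_leqif (mxrank_leqif_sup (sub_ker w Mw))).
  by rewrite (leq_trans rk_le1) // lt0n mxrank_eq0 trmx_eq0.
move=> /(submx_trans (sub_ker y My)) /sub_rVP [c yw].
by exists c; apply: trmx_inj; rewrite yw linearZ.
Qed.

Lemma left_ker_exists (F : fieldType) n (M : 'M[F]_n) (u : 'cV[F]_n) :
  u != 0 -> M *m u = 0 -> exists2 f : 'rV[F]_n, f != 0 & f *m M = 0.
Proof.
move=> u0 Mu; apply/det0P; rewrite -det_tr; apply/det0P.
by exists u^T; rewrite ?trmx_eq0 // -trmx_mul Mu trmx0.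
Qed.

(** If [f *m Y] is nonzero, it kills [y], and also [w] because [f Y w = f X w = 0]; hence [w] is
    parallel to [y] and [X w = Y w = 0]. As [X] is nonzero, its kernel is spanned by [w], so [u] is
    a multiple of [w]. *)
Lemma singular_diff_common_ker (F : fieldType) (X Y : 'M[F]_2)
    (f : 'rV[F]_2) (u w y : 'cV[F]_2) :
  X != 0 -> X *m u = 0 -> f *m X = 0 ->
  w != 0 -> X *m w = Y *m w -> y != 0 -> Y *m y = 0 ->
  Y *m u = 0 \/ f *m Y = 0.
Proof.
move=> X0 Xu fX w0 XYw y0 Yy.
have [fY0 | fY] := eqVneq (f *m Y) 0; first by right.
left.
have fYw : f *m Y *m w = 0 by rewrite -mulmxA -XYw mulmxA fX mul0mx.
have fYy : f *m Y *m y = 0 by rewrite -mulmxA Yy mulmx0.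
have [c wy] := ker_col2_parallel fY y0 fYy fYw.
have Yw : Y *m w = 0 by rewrite wy -scalemxAr Yy scaler0.
have [d ->] := ker_col2_parallel X0 w0 (etrans XYw Yw) Xu.
by rewrite -scalemxAr Yw scaler0.
Qed.

Lemma singular_clique (F : finFieldType) (D : {set 'M[F]_2}) :
  0 \in D ->
  (forall X Y, X \in D -> Y \in D -> exists2 u : 'cV[F]_2, u != 0 & X *m u = Y *m u) ->
  (exists2 u : 'cV[F]_2, u != 0 & forall X, X \in D -> X *m u = 0) \/
  (exists2 f : 'rV[F]_2, f != 0 & forall X, X \in D -> f *m X = 0).
Proof.
move=> D0 Dsing.
have kerP X : X \in D -> exists2 u : 'cV[F]_2, u != 0 & X *m u = 0.
  by move=> DX; have [u u0] := Dsing X 0 DX D0; rewrite mul0mx; exists u.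
case: (boolP [forall X in D, X == 0]) => [/forall_inP D_0 | ].
  left; have [u u0 _] := kerP 0 D0.
  by exists u => // X /D_0/eqP->; rewrite mul0mx.
case/forall_inPn=> X DX X0.
have [u u0 Xu] := kerP X DX.
have [f f0 fX] := left_ker_exists u0 Xu.
case: (boolP [forall Y in D, Y *m u == 0]) => [/forall_inP Du | ].
  by left; exists u => // Y /Du/eqP.
case/forall_inPn=> Y DY /eqP Yu.
case: (boolP [forall Z in D, f *m Z == 0]) => [/forall_inP Df | ].
  by right; exists f => // Z /Df/eqP.
case/forall_inPn=> Z DZ /eqP fZ; exfalso.
(* Every member shares the right kernel vector [u] or the left kernel vector [f] of the fixed
   nonzero [X]. It remains to exclude that [Y] violates the first and [Z] the second. *)
have step W : W \in D -> W *m u = 0 \/ f *m W = 0.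
  move=> DW; have [w w0 XWw] := Dsing X W DX DW; have [y y0 Wy] := kerP W DW.
  exact: singular_diff_common_ker XWw y0 Wy.
have fY : f *m Y = 0 by case: (step Y DY).
have Zu : Z *m u = 0 by case: (step Z DZ).
have Y0 : Y != 0 by apply/eqP => Y0; apply: Yu; rewrite Y0 mul0mx.
have Z0 : Z != 0 by apply/eqP => Z0; apply: fZ; rewrite Z0 mulmx0.
have [v v0 Yv] := kerP Y DY.
have [w w0 YZw] := Dsing Y Z DY DZ.
(* Now [Y] takes the role of [X], with kernels [v] and [f]. Since [f Z] is nonzero, [Z v = 0]; as
   [Z u = 0] too, [u] is parallel to [v], contradicting [Y u <> 0]. *)
case: (singular_diff_common_ker Y0 Yv fY w0 YZw u0 Zu) => // Zv.
have [c uv] := ker_col2_parallel Z0 v0 Zv Zu.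
by apply: Yu; rewrite uv -scalemxAr Yv scaler0.
Qed.

(** * Actions on vectors and covectors, and the orders of their stabilizers *)

Definition covec_act (F : finFieldType) (g : 'rV[F]_2) (A : {'GL_2[F]}) : 'rV[F]_2 :=
  g *m GLval A.

Lemma covec_act_is_action (F : finFieldType) : is_action [set: {'GL_2[F]}] (@covec_act F).
Proof.
apply: is_total_action => [g | g A B]; first by rewrite /covec_act GL_1E mulmx1.
by rewrite /covec_act GL_ME mulmxA.
Qed.

Canonical covec_action (F : finFieldType) := Action (@covec_act_is_action F).

(* [glact] is a left action, so inverses are needed to make it a right action. *)
Definition vec_act (F : finFieldType) (u : 'cV[F]_2) (A : {'GL_2[F]}) : 'cV[F]_2 :=
  glact A^-1%g u.

Lemma glactM (F : finFieldType) (A B : {'GL_2[F]}) u :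
  glact (A * B)%g u = glact A (glact B u).
Proof. by rewrite /glact GL_ME mulmxA. Qed.

Lemma glact1 (F : finFieldType) (u : 'cV[F]_2) : glact 1%g u = u.
Proof. by rewrite /glact GL_1E mul1mx. Qed.

Lemma glactK (F : finFieldType) (A : {'GL_2[F]}) : cancel (glact A) (glact A^-1%g).
Proof. by move=> u; rewrite -glactM mulVg glact1. Qed.

Lemma vec_act_is_action (F : finFieldType) : is_action [set: {'GL_2[F]}] (@vec_act F).
Proof.
apply: is_total_action => [u | u A B]; first by rewrite /vec_act invg1 glact1.
by rewrite /vec_act invMg glactM.
Qed.

Canonical vec_action (F : finFieldType) := Action (@vec_act_is_action F).

Definition covec_stab (F : finFieldType) (H : {group {'GL_2[F]}}) (g : 'rV[F]_2) :
    {set {'GL_2[F]}} :=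
  [set A in H | g *m GLval A == g].

Lemma covec_stabE (F : finFieldType) (H : {group {'GL_2[F]}}) g :
  covec_stab H g = 'C_H[g | covec_action F].
Proof. by apply/setP=> A; rewrite !inE sub1set inE. Qed.

Lemma point_stabE (F : finFieldType) (H : {group {'GL_2[F]}}) u :
  point_stab H u = 'C_H[u | vec_action F].
Proof.
have fixV B : glact B u = u -> glact B^-1%g u = u.
  by move=> Bu; rewrite -{1}Bu glactK.
apply/setP=> A; rewrite !inE sub1set inE; congr andb.
by apply/eqP/eqP=> [/fixV | /fixV]; rewrite ?invgK.
Qed.

Lemma card_fixed_covec (F : finFieldType) n (A : 'M[F]_n) :
  #|[set g : 'rV[F]_n | g *m A == g]| = #|[set u : 'cV[F]_n | A *m u == u]|.
Proof.
have fixE (B : 'M[F]_n) : [set g : 'rV[F]_n | g *m B == g] = rowg (kermx (B - 1%:M)).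
  apply/setP=> g; rewrite !inE -subr_eq0 -{2}[g]mulmx1 -mulmxBr.
  by apply/eqP/sub_kermxP.
have trE : [set u : 'cV[F]_n | A *m u == u] =
    [set g^T | g in [set g : 'rV[F]_n | g *m A^T == g]].
  apply/setP=> u; rewrite inE; apply/eqP/imsetP => [Au | [g]].
    by exists u^T; rewrite ?trmxK // inE -trmx_mul Au.
  by rewrite inE => /eqP gA ->; rewrite -{2}gA trmx_mul trmxK.
rewrite trE card_imset; last exact: trmx_inj.
rewrite !fixE !card_rowg !mxrank_ker -[1%:M in RHS]tr_scalar_mx.
by rewrite -linearB mxrank_tr.
Qed.

Lemma card_Omega_row (F : finFieldType) : #|[set g : 'rV[F]_2 | g != 0]| = #|Omega F|.
Proof.
rewrite -(card_imset _ (@trmx_inj F 1 2)); apply: eq_card => u; rewrite inE.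
apply/imsetP/idP => [[g] | u0]; first by rewrite inE => g0 ->; rewrite trmx_eq0.
by exists u^T; rewrite ?trmxK // inE trmx_eq0.
Qed.

(** Both sides count pairs of an element of [H] and a nonzero vector or covector that it fixes. *)
Lemma sum_card_stab (F : finFieldType) (H : {group {'GL_2[F]}}) :
  (\sum_(g : 'rV[F]_2 | g != 0%R) #|covec_stab H g| = \sum_(u in Omega F) #|point_stab H u|)%N.
Proof.
have card_sum (T : finType) (p : T -> pred {'GL_2[F]}) :
    (\sum_x #|[set A in H | p x A]| = \sum_(A in H) #|[set x | p x A]|)%N.
  under eq_bigr do rewrite -sum1dep_card.
  rewrite (exchange_big_dep (mem H)) /=; last by move=> x A _ /andP[].
  by apply: eq_bigr => A AH; rewrite -sum1dep_card; apply: eq_bigl => x; rewrite AH.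
have := card_sum 'cV[F]_2 (fun u A => glact A u == u).
under [in RHS]eq_bigr do rewrite -card_fixed_covec.
rewrite -(card_sum 'rV[F]_2 (fun g A => g *m GLval A == g)).
(* The zero vector and the zero covector are fixed by all of [H], so both contribute [#|H|] and
   cancel. *)
rewrite (bigD1 (0 : 'cV[F]_2)) //= [in RHS](bigD1 (0 : 'rV[F]_2)) //=.
have -> : [set A in H | glact A 0 == 0] = H :> {set _}.
  by apply/setP=> A; rewrite inE /glact mulmx0 eqxx andbT.
have -> : [set A in H | (0 : 'rV[F]_2) *m GLval A == 0] = H :> {set _}.
  by apply/setP=> A; rewrite inE mul0mx eqxx andbT.
by move/addnI <-; apply: eq_bigl => u; rewrite inE.
Qed.

Lemma card_point_stab (F : finFieldType) (H : {group {'GL_2[F]}}) u :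
  transitive_on_Omega H -> u \in Omega F ->
  (#|Omega F| * #|point_stab H u|)%N = #|H|.
Proof.
move=> Htrans Ou; rewrite point_stabE -(card_orbit_stab (vec_action F) H u).
congr (_ * _)%N; apply: eq_card => v; apply/idP/orbitP => [Ov | [A _ <-]].
  have [A AH <-] := Htrans u v Ou Ov.
  by exists A^-1%g; rewrite ?groupV //= /vec_act invgK.
move: Ou; rewrite !inE; apply: contra => /eqP Au0.
by rewrite -(glactK A^-1%g u) -/(vec_act u A) [vec_act u A]Au0 /glact mulmx0.
Qed.

(** The orbit of [g] lies among the nonzero covectors, which are as many as the points of [Omega F];
    that it is all of them is not yet known. *)
Lemma card_covec_stab_ge (F : finFieldType) (H : {group {'GL_2[F]}}) (g : 'rV[F]_2) :
  g != 0 -> (#|H| <= #|Omega F| * #|covec_stab H g|)%N.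
Proof.
move=> g0; rewrite covec_stabE -(card_orbit_stab (covec_action F) H g).
rewrite leq_mul2r -card_Omega_row subset_leq_card ?orbT //.
apply/subsetP=> _ /orbitP[A _ <-]; rewrite inE /= /covec_act.
by apply: contra g0 => /eqP gA; rewrite -(mulmxK (GL_unitmx A) g) gA mul0mx.
Qed.

Lemma card_covec_stab (F : finFieldType) (H : {group {'GL_2[F]}}) (g : 'rV[F]_2) u :
  transitive_on_Omega H -> g != 0 -> u \in Omega F ->
  #|covec_stab H g| = #|point_stab H u|.
Proof.
move=> Htrans g0 Ou.
have Omega_gt0 : (0 < #|Omega F|)%N by apply/card_gt0P; exists u.
have eq_stab v : v \in Omega F -> #|point_stab H v| = #|point_stab H u|.
  by move=> Ov; apply/eqP; rewrite -(eqn_pmul2l Omega_gt0) !card_point_stab.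
have ge_stab f : f != 0 -> (#|point_stab H u| <= #|covec_stab H f|)%N.
  by move=> f0; rewrite -(leq_pmul2l Omega_gt0) card_point_stab // card_covec_stab_ge.
have sum_eq : (\sum_(f : 'rV[F]_2 | f != 0%R) #|point_stab H u| =
               \sum_(f : 'rV[F]_2 | f != 0%R) #|covec_stab H f|)%N.
  rewrite sum_card_stab (eq_bigr _ eq_stab) !sum_nat_const -card_Omega_row.
  by congr (_ * _)%N; apply: eq_card => f; rewrite inE.
(* Termwise inequality together with equal sums forces equality in every term. *)
have /leqif_sum [_] : forall f : 'rV[F]_2, f != 0 ->
    (#|point_stab H u| <= #|covec_stab H f| ?= iff (#|point_stab H u| == #|covec_stab H f|))%N.
  by move=> f f0; split; rewrite ?ge_stab.
by rewrite sum_eq eqxx => /esym /forall_inP /(_ g g0) /eqP.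
Qed.

(** * From common kernels to cosets of stabilizers *)

Lemma intersecting_in_stab_coset (F : finFieldType) (H : {group {'GL_2[F]}})
    (S : {set {'GL_2[F]}}) A0 :
  S \subset H -> intersecting S -> A0 \in S ->
  (exists2 u, u \in Omega F & S \subset (A0 *: point_stab H u)%g) \/
  (exists2 g, g != 0 & S \subset (A0 *: covec_stab H g)%g).
Proof.
move=> /subsetP SH Sint SA0.
pose D := [set GLval A - GLval A0 | A in S].
have D0 : 0 \in D by apply/imsetP; exists A0; rewrite ?subrr.
have Dsing X Y : X \in D -> Y \in D -> exists2 u : 'cV[F]_2, u != 0 & X *m u = Y *m u.
  move=> /imsetP[A SA ->] /imsetP[B SB ->]; have [u] := Sint A B SA SB.
  by rewrite inE /glact => u0 ABu; exists u; rewrite // !mulmxBl ABu.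
case: (singular_clique D0 Dsing) => [[u u0 Du] | [f f0 fD]].
  left; exists u; rewrite ?inE //.
  apply/subsetP=> A SA; rewrite mem_lcoset inE groupM ?groupV ?SH //= glactM.
  have /eqP := Du _ (imset_f _ SA); rewrite mulmxBl subr_eq0 => /eqP Au.
  by rewrite [glact A u]Au -/(glact A0 u) glactK.
(* All [A] in [S] have the same product [f A = f A0]; so [g = f A0] satisfies
   [g (A0^-1 A) = f A = g]. *)
right; exists (f *m GLval A0).
  by apply: contra f0 => /eqP fA; rewrite -(mulmxK (GL_unitmx A0) f) fA mul0mx.
apply/subsetP=> A SA; rewrite mem_lcoset inE groupM ?groupV ?SH //=.
have /eqP := fD _ (imset_f _ SA); rewrite mulmxBr subr_eq0 => /eqP fA.
by rewrite -mulmxA -[GLval A0 *m _]/(GLval (A0 * (A0^-1 * A))%g) mulKVg fA.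
Qed.

Lemma covec_stab_sub_line_stab (F : finFieldType) (H : {group {'GL_2[F]}}) (g : 'rV[F]_2) :
  g != 0 -> exists2 L, L \in O2 F & covec_stab H g \subset line_stab H L.
Proof.
move=> g0.
have [v gv] : exists v : 'cV[F]_2, g *m v = 1%:M.
  exists (pinvmx g); apply: mulmxVp.
  by rewrite /row_free eqn_leq rank_leq_row lt0n mxrank_eq0.
have [u u0 gu] : exists2 u : 'cV[F]_2, u != 0 & g *m u = 0.
  have /rowV0Pn[w /sub_kermxP wg w0] : kermx g^T != 0.
    rewrite -mxrank_eq0 mxrank_ker mxrank_tr -lt0n subn_gt0.
    by rewrite ltnS rank_leq_row.
  by exists w^T; rewrite ?trmx_eq0 //; apply: trmx_inj; rewrite trmx_mul trmxK wg trmx0.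
(* With [g v = 1] and [u] spanning the kernel of [g], the line through [v] in direction [u] is the
   level set [g x = 1]. *)
have lineP x : (x \in line v u) = (g *m x == 1%:M).
  apply/imsetP/eqP => [[t _ ->] | gx].
    by rewrite mulmxDr gv -scalemxAr gu scaler0 addr0.
  have gxv : g *m (x - v) = 0 by rewrite mulmxBr gx gv subrr.
  by have [t xv] := ker_col2_parallel g0 u0 gu gxv; exists t; rewrite // -xv addrC subrK.
exists (line v u).
  rewrite inE; apply/existsP; exists v; apply/existsP; exists u.
  rewrite eqxx andbT free_cons span_seq1 seq1_free.
  apply/andP; split; last first.
    by apply/eqP => v0; move/eqP: gv; rewrite v0 mulmx0 eq_sym oner_eq0.
  apply/vlineP => -[c uv]; have := gu; rewrite uv -scalemxAr gv.
  move/matrixP/(_ 0 0); rewrite !mxE mulr1 => c0.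
  by move: u0; rewrite uv c0 scale0r eqxx.
apply/subsetP=> A; rewrite !inE => /andP[-> /eqP gA] /=.
(* As [A] acts injectively, it is enough that it maps the line into itself. *)
rewrite eqEcard (card_imset _ (can_inj (glactK A))) leqnn andbT.
apply/subsetP=> y /imsetP[x]; rewrite lineP => /eqP gx ->.
by rewrite lineP /glact mulmxA gA gx.
Qed.

Theorem theorem1p4 (F : finFieldType) (H : {group {'GL_2[F]}})
    (Htrans : transitive_on_Omega H) :
  EKR_property H /\
  (forall S : {set {'GL_2[F]}}, S \subset H -> intersecting S ->
     (exists2 u, u \in Omega F & in_coset_of H (point_stab H u) S) \/
     (exists2 L, L \in O2 F & in_coset_of H (line_stab H L) S)).
Proof.
split=> S SH Sint.
  move=> u Ou; have [-> | [A0 SA0]] := set_0Vmem S; first by rewrite cards0.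
  case: (intersecting_in_stab_coset SH Sint SA0) => [[v Ov] | [g g0]] /subset_leq_card.
    rewrite card_lcoset => /leq_trans; apply.
    (* The points [u] and [v] may differ, but by transitivity their stabilizers have the same
       order. *)
    have Omega_gt0 : (0 < #|Omega F|)%N by apply/card_gt0P; exists u.
    by rewrite -(leq_pmul2l Omega_gt0) !card_point_stab.
  by rewrite card_lcoset (card_covec_stab Htrans g0 Ou).
have [-> | [A0 SA0]] := set_0Vmem S.
  (* For empty [S] any nonzero vector will do. *)
  left; exists (const_mx 1); last by exists 1%g; rewrite ?group1 ?sub0set.
  by rewrite inE; apply/eqP => /matrixP/(_ 0 0)/eqP; rewrite !mxE oner_eq0.
have HA0 := subsetP SH A0 SA0.
case: (intersecting_in_stab_coset SH Sint SA0) => [[u Ou Su] | [g g0 Sg]].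
  by left; exists u => //; exists A0.
have [L OL gL] := covec_stab_sub_line_stab H g0.
right; exists L => //; exists A0 => //; exact: subset_trans Sg (mulgS _ gL).
Qed.
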